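(* Let $n\in\mathbb{N}_+$ and let $\lambda,\mu$ be partitions. If $\langle s_\mu,\ p_n\circ s_\lambda\rangle\neq 0$, then $[\lambda]\subseteq[\mu]$, i.e. $\lambda_i\le\mu_i$ for all $i$.
   Context: $p_n$ is the $n$-th power sum symmetric function, $\circ$ denotes plethysm, so that $p_n\circ s_\lambda=s_\lambda(x_1^n,x_2^n,\dots)$, and $\langle\cdot,\cdot\rangle$ is the Hall inner product on symmetric functions, for which the Schur functions are orthonormal. For a partition $\lambda$, its diagram is $[\lambda]=\{(j,i)\in\mathbb{N}_0^2:0\le j<\lambda_{i+1}\}$. *)

(* Defs.v *)
From HB Require Import structures.
From mathcomp Require Import all_boot all_order all_algebra.
From mathcomp Require Import mpoly.
Set Implicit Arguments. Unset Strict Implicit. Unset Printing Implicit Defensive.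
Import Order.TTheory GRing.Theory Num.Theory.
Local Open Scope ring_scope.

(* A partition is a weakly decreasing finite sequence of positive integers;
   lambda_{i+1} is [nth 0 la i] (0 beyond the length). *)
Definition is_part (la : seq nat) : bool :=
  sorted geq la && (0%N \notin la).

Definition in_diag (la : seq nat) (p : 'I_(size la) * 'I_(head 0%N la)) : bool :=
  (p.2 < nth 0%N la p.1)%N.
Arguments in_diag : clear implicits.

Definition cell (la : seq nat) := {p : 'I_(size la) * 'I_(head 0%N la) | in_diag la p}.

Definition crow la (x : cell la) : nat := (val x).1.
Definition ccol la (x : cell la) : nat := (val x).2.

Definition is_ssyt (N : nat) (la : seq nat) (T : {ffun cell la -> 'I_N}) : bool :=
  [forall a, forall b,
     ((crow a == crow b) && (ccol a < ccol b)%N ==> (T a <= T b)%N) &&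
     ((ccol a == ccol b) && (crow a < crow b)%N ==> (T a < T b)%N)].

Definition schur (N : nat) (la : seq nat) : {mpoly rat[N]} :=
  \sum_(T : {ffun cell la -> 'I_N} | is_ssyt T) \prod_(x : cell la) 'X_(T x).

Definition pleth_p (N n : nat) (f : {mpoly rat[N]}) : {mpoly rat[N]} :=
  comp_mpoly [tuple ('X_i : {mpoly rat[N]}) ^+ n | i < N] f.
Arguments pleth_p : clear implicits.
Arguments schur : clear implicits.

(* Main.v *)
(** Suppose [mu_i < la_i] and put [b = la_i - 1].  Split the [N] variables into
    [M = N - i] variables z and [i] variables x, and add [b] auxiliary variables
    y.  Let [V] be the Vandermonde product in the [p = M + b] variables (z, y).
    Multiplication by [V] sends every symmetric function of (z, y) without
    constant term into the ideal generated by the p-th powers of z and y; so,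
    modulo the transporter of that ideal by [V], the product of the
    [t - z_j^n] divides [t^p], i.e. y^n behaves like a set of negative variables.
    The Schur polynomial of a shape with first row longer than [b], evaluated at
    z^n, is a determinant of coefficients of powers of [t] modulo this product,
    one of whose columns consists of coefficients of some [t^e], [e >= p], hence it
    vanishes modulo the transporter.  Branching over the [i] variables x extends
    this to [s_la (z^n, x^n)].  Finally [c mu] is, up to sign, the coefficient in
    [(\sum_nu c nu *: a_(nu + delta)) * V(z, y) / V(z)] of a monomial all of whose
    exponents in z and y are smaller than [p]. *)

Require Import Defs.
From HB Require Import structures.
From mathcomp Require Import all_boot all_order all_algebra.
From mathcomp Require Import perm zify ring.
From mathcomp Require Import mpoly.
Set Implicit Arguments.
Unset Strict Implicit.
Unset Printing Implicit Defensive.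
Import GRing.Theory.
Local Open Scope ring_scope.

(** * Alternants and interlacing shapes *)

(** Shapes are functions on [nat]; those summed over are finite functions with values at most [C],
    so that the sums are finite. [C] is any bound on the first part. *)
Definition interlace k C (kap : nat -> nat) (f : {ffun 'I_k -> 'I_C.+1}) :=
  [forall j : 'I_k, (kap j.+1 <= f j <= kap j)%N].

Definition shape_of k C (f : {ffun 'I_k -> 'I_C.+1}) (j : nat) : nat :=
  if insub j is Some o then f o else 0%N.

Definition noninc (kap : nat -> nat) := forall j, (kap j.+1 <= kap j)%N.

Lemma noninc_leq kap i j : noninc kap -> (i <= j)%N -> (kap j <= kap i)%N.
Proof.
move=> kapP; elim: j => [|j IH]; first by rewrite leqn0 => /eqP->.
rewrite leq_eqVlt => /orP[/eqP-> //|]; rewrite ltnS => /IH; exact: leq_trans.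
Qed.

Lemma shape_ofE k C (f : {ffun 'I_k -> 'I_C.+1}) (j : 'I_k) : shape_of f j = f j.
Proof. by rewrite /shape_of valK. Qed.

Lemma shape_of_out k C (f : {ffun 'I_k -> 'I_C.+1}) j :
  (k <= j)%N -> shape_of f j = 0%N.
Proof. by move=> le_kj; rewrite /shape_of insubN // -leqNgt. Qed.

Lemma shape_of_leq k C (f : {ffun 'I_k -> 'I_C.+1}) j : (shape_of f j <= C)%N.
Proof. by rewrite /shape_of; case: insubP => // o _ _; rewrite -ltnS. Qed.

Lemma interlaceP k C kap (f : {ffun 'I_k -> 'I_C.+1}) :
  reflect (forall j, (j < k)%N -> (kap j.+1 <= shape_of f j <= kap j)%N)
          (interlace kap f).
Proof.
apply: (iffP forallP) => [H j lt_jk | H j]; last by rewrite -shape_ofE H.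
by rewrite -[j]/(val (Ordinal lt_jk)) shape_ofE; apply: (H (Ordinal lt_jk)).
Qed.

Lemma interlace_noninc k C kap (f : {ffun 'I_k -> 'I_C.+1}) :
  interlace kap f -> noninc (shape_of f).
Proof.
move=> /interlaceP H j; have [lt_jk|] := ltnP j.+1 k; last first.
  by move=> le_kj; rewrite shape_of_out.
case/andP: (H _ lt_jk) => _ /leq_trans; apply.
by case/andP: (H _ (ltnW lt_jk)).
Qed.

Section Alternants.
Variables (R : comNzRingType) (C : nat) (x : nat -> R).

(** A sum over Gelfand-Tsetlin patterns with top row [kap]: the exponent of the last variable is the
    size of the horizontal strip between [kap] and [f]. For nonincreasing [kap] bounded by [C] this
    is the Schur polynomial of the first [k] parts. *)
Fixpoint gtsum k (kap : nat -> nat) : R :=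
  if k is k'.+1 then
    \sum_(f : {ffun 'I_k' -> 'I_C.+1} | interlace kap f)
      (\prod_(j < k') x k' ^+ (kap j - f j)) * x k' ^+ kap k' *
      gtsum k' (shape_of f)
  else 1.

Definition alternant k (kap : nat -> nat) : R :=
  \det (\matrix_(i < k, l < k) x i ^+ (kap l + (k.-1 - l))).

(** The lower bound [m] serves for quotients: this is the Vandermonde product of the first [k]
    variables divided by that of the first [m]. *)
Definition vdm m k : R := \prod_(m <= i < k) \prod_(j < i) (x j - x i).

(** A geometric sum indexed by the values that an interlacing part may take; it divides the entries
    of the reduced matrix in [alternantS] by [x i - x k]. *)
Lemma subrX_interval (a y : R) (m n e : nat) : (m <= n)%N -> (n <= C)%N ->
  a ^+ (n + e.+1) - a ^+ (m + e) * y ^+ (n.+1 - m) =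
  (a - y) * \sum_(q < C.+1 | (m <= q <= n)%N) a ^+ (q + e) * y ^+ (n - q).
Proof.
move=> le_mn le_nC.
have -> : \sum_(q < C.+1 | (m <= q <= n)%N) a ^+ (q + e) * y ^+ (n - q) =
          a ^+ (m + e) * \sum_(i < n.+1 - m) a ^+ ((n.+1 - m).-1 - i) * y ^+ i.
  rewrite -(big_mkord (fun q => (m <= q <= n)%N)
             (fun q => a ^+ (q + e) * y ^+ (n - q))).
  rewrite mulr_sumr -(big_mkord xpredT
    (fun i => a ^+ (m + e) * (a ^+ ((n.+1 - m).-1 - i) * y ^+ i))).
  rewrite (big_cat_nat _ (n := m)) //=; last by lia.
  rewrite big_nat_cond big_pred0 ?add0r; last by move=> i /=; lia.
  rewrite (big_cat_nat _ (n := n.+1)) //=; try lia.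
  rewrite [X in _ + X]big_nat_cond [X in _ + X]big_pred0 ?addr0; last first.
    by move=> i /=; lia.
  rewrite big_nat_cond (eq_bigl (fun i => (m <= i < n.+1)%N && true)); last first.
    by move=> i; lia.
  rewrite -big_nat_cond.
  rewrite big_nat_rev /= -{1}[m]add0n big_addn; apply: eq_big_nat => i Hi.
  by rewrite mulrA -exprD; congr (_ ^+ _ * _ ^+ _); lia.
rewrite mulrCA -subrXX mulrBr -exprD; congr (_ ^+ _ - _); lia.
Qed.

(** Multilinearity in the columns: [f] records which term is chosen in each column. *)
Lemma det_expand_columns k (Q : 'I_k -> pred 'I_C.+1)
    (F : 'I_k -> 'I_k -> 'I_C.+1 -> R) (G : 'I_k -> 'I_C.+1 -> R) :
  \det (\matrix_(i, l) \sum_(q | Q l q) F i l q * G l q) =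
  \sum_(f : {ffun 'I_k -> 'I_C.+1} | [forall l, Q l (f l)])
    (\prod_l G l (f l)) * \det (\matrix_(i, l) F i l (f l)).
Proof.
rewrite -[LHS]det_tr {1}/determinant.
under eq_bigr => s _.
  under eq_bigr => l _ do rewrite !mxE.
  rewrite bigA_distr_big_dep mulr_sumr; over.
rewrite exchange_big /=; apply: eq_big => [f|f _].
  by apply/familyP/forallP.
rewrite -[in RHS]det_tr /determinant mulr_sumr; apply: eq_bigr => s _.
rewrite mulrCA; congr (_ * _).
rewrite -big_split; apply: eq_bigr => l _ /=.
by rewrite !mxE mulrC.
Qed.

(** Column operations clear the last row except for its last entry. Row [i] of the remaining minor
    is divisible by [x i - x k], the quotients are geometric sums, and expanding them by columns
    produces the interlacing shapes. *)
Lemma alternantS k kap : noninc kap -> (kap 0 <= C)%N ->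
  alternant k.+1 kap =
  (\prod_(i < k) (x i - x k)) *
  \sum_(f : {ffun 'I_k -> 'I_C.+1} | interlace kap f)
    (\prod_(j < k) x k ^+ (kap j - f j)) * x k ^+ kap k *
    alternant k (shape_of f).
Proof.
move=> kapP kapC; rewrite /alternant; set A := (X in \det X = _).
(* Right multiplication by this unitriangular matrix subtracts from column [l] the multiple of
   column [l.+1] that cancels its entry in the row of [x k]. *)
pose B : 'M[R]_k.+1 := \matrix_(j, l)
  ((j == l)%:R - (j == l.+1 :> nat)%:R * x k ^+ ((kap l).+1 - kap l.+1)).
have detB : \det B = 1.
  rewrite det_trig; last first.
    apply/forallP=> i; apply/forallP => j; apply/implyP => lt_ij; rewrite mxE.
    have -> : (i == j) = false by apply/negbTE/eqP => E; move: lt_ij; rewrite E ltnn.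
    have -> : (i == j.+1 :> nat) = false by lia.
    by rewrite mul0r subr0.
  apply: big1 => i _; rewrite mxE eqxx.
  by rewrite ltn_eqF // mul0r subr0.
have AB i l : (A *m B) i l = x i ^+ (kap l + (k - l)) -
   (if (l < k)%N then x i ^+ (kap l.+1 + (k - l.+1)) *
      x k ^+ ((kap l).+1 - kap l.+1) else 0).
  rewrite mxE; under eq_bigr => j _ do rewrite !mxE mulrBr /=.
  rewrite sumrB (bigD1 l) //= eqxx mulr1 big1 ?addr0; last first.
    by move=> j /negPf->; rewrite mulr0.
  congr (_ - _); case: ltnP => [lt_lk | le_kl]; last first.
    apply: big1 => j _; have -> : (j == l.+1 :> nat) = false.
      by have := ltn_ord j; lia.
    by rewrite mul0r mulr0.
  have Hl : (l.+1 < k.+1)%N by [].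
  rewrite (bigD1 (Ordinal Hl)) //= eqxx mul1r big1 ?addr0 //.
  move=> j Hj; have -> : (j == l.+1 :> nat) = false.
    by apply/negbTE/eqP => E; case/eqP: Hj; apply: val_inj.
  by rewrite mul0r mulr0.
have -> : \det A = \det (A *m B) by rewrite det_mulmx detB mulr1.
rewrite (expand_det_row _ ord_max).
rewrite (bigD1 ord_max) //= [X in _ + X]big1 ?addr0; last first.
  move=> l Hl; have lt_lk : (l < k)%N.
    rewrite ltn_neqAle -ltnS ltn_ord andbT.
    by apply/eqP => E; case/eqP: Hl; apply: val_inj.
  rewrite AB /= lt_lk -exprD.
  have := kapP l => Hk.
  have -> : (kap l.+1 + (k - l.+1) + ((kap l).+1 - kap l.+1) =
             kap l + (k - l))%N by lia.
  by rewrite subrr mul0r.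
rewrite AB /= ltnn subnn addn0 subr0 /cofactor /= addnn -signr_odd odd_double.
rewrite expr0 mul1r.
set M := row' _ _.
have -> : M = diag_mx (\row_i (x i - x k)) *m
  \matrix_(i < k, l < k) \sum_(q < C.+1 | (kap l.+1 <= q <= kap l)%N)
     x i ^+ (q + (k.-1 - l)) * x k ^+ (kap l - q).
  apply/matrixP => i l; rewrite mul_diag_mx !mxE /=.
  have := AB (lift ord_max i) (lift ord_max l); rewrite !mxE => ->.
  rewrite !lift_max ltn_ord.
  rewrite -subrX_interval //; last by apply: leq_trans kapC; apply: noninc_leq.
  have Hl := ltn_ord l.
  by congr (_ ^+ _ - _ ^+ _ * _); lia.
rewrite det_mulmx det_diag; under eq_bigr => i _ do rewrite mxE.
rewrite mulrCA; congr (_ * _).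
have /= -> := @det_expand_columns k (fun l q => (kap l.+1 <= q <= kap l)%N)
  (fun i l (q : 'I_C.+1) => x i ^+ (q + (k.-1 - l)))
  (fun l (q : 'I_C.+1) => x k ^+ (kap l - q)).
rewrite mulr_sumr; apply: eq_bigr => f _; rewrite mulrA.
rewrite [x k ^+ _ * _]mulrC; congr (_ * _); congr determinant.
by apply/matrixP => i l; rewrite !mxE shape_ofE.
Qed.

(* The bialternant formula. *)
Lemma alternant_gtsum k kap : noninc kap -> (kap 0 <= C)%N ->
  alternant k kap = vdm 0 k * gtsum k kap.
Proof.
elim: k kap => [|k IH] kap kapP kapC.
  by rewrite /alternant det_mx00 /vdm big_geq // mul1r.
rewrite alternantS // /vdm big_nat_recr //= [_ * \prod_(i < k) _]mulrC -mulrA.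
congr (_ * _); rewrite mulr_sumr; apply: eq_bigr => f Hf.
rewrite IH ?shape_of_leq //; last exact: interlace_noninc Hf.
by rewrite [LHS]mulrCA.
Qed.

Lemma eq_gtsum k kap kap' :
  (forall j, (j < k)%N -> kap j = kap' j) -> gtsum k kap = gtsum k kap'.
Proof.
case: k => //= k E; apply: eq_big => [f|f _].
  by apply: eq_forallb => j; rewrite !E // ltnS // ltnW.
rewrite E //; congr (_ * _ * _); apply: eq_bigr => j _.
by rewrite E // ltnS ltnW.
Qed.

(** Together with [alternant_gtsum] this gives the Vandermonde determinant. *)
Lemma gtsum0 k : gtsum k (fun=> 0%N) = 1.
Proof.
elim: k => //= k IH; rewrite (big_pred1 [ffun=> ord0]) => [|f].
  rewrite big1 ?mul1r ?expr0 ?mul1r => [|j _]; last by rewrite ffunE.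
  rewrite -[RHS]IH; apply: eq_gtsum => j lt_jk.
  by rewrite -[j]/(val (Ordinal lt_jk)) shape_ofE ffunE.
apply/forallP/eqP => [H|-> j]; last by rewrite ffunE.
by apply/ffunP => j; apply/val_inj/eqP; rewrite ffunE /= -leqn0; apply: H.
Qed.

End Alternants.

(** * Branching of semistandard tableaux *)

Section Tableaux.
Variables (R : comNzRingType) (x : nat -> R) (la : seq nat) (N : nat).
Hypothesis la_part : is_part la.

Lemma part_noninc (nu : seq nat) : is_part nu -> noninc (nth 0%N nu).
Proof.
case/andP=> nu_sorted _ j; have [lt_j|] := ltnP j.+1 (size nu); last first.
  by move=> le_j; rewrite nth_default.
have geq_trans : transitive geq by move=> b a c ab bc; apply: leq_trans bc ab.
by apply: (sorted_ltn_nth geq_trans 0%N nu_sorted); rewrite ?inE // ltnW.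
Qed.

Let la_noninc := part_noninc la_part.

Lemma ccolP (c : cell la) : (ccol c < nth 0%N la (crow c))%N.
Proof. by rewrite /ccol /crow; case: c. Qed.

Lemma cell_inj (c d : cell la) : crow c = crow d -> ccol c = ccol d -> c = d.
Proof.
case: c => [[i j] H]; case: d => [[i' j'] H']; rewrite /crow /ccol /= => E F.
apply: val_inj => /=; congr (_, _); exact: val_inj.
Qed.

Lemma cell_exists i j : (j < nth 0%N la i)%N ->
  exists c : cell la, crow c = i /\ ccol c = j.
Proof.
move=> lt_j; have lt_i : (i < size la)%N.
  by rewrite ltnNge; apply: contraTN lt_j => le_i; rewrite nth_default.
have lt_j0 : (j < head 0%N la)%N.
  by rewrite -nth0; apply: leq_trans lt_j _; apply: noninc_leq.
have H : in_diag la (Ordinal lt_i, Ordinal lt_j0) by [].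
by exists (exist (in_diag la) _ H).
Qed.

Definition in_shape (kap : nat -> nat) (c : cell la) := (ccol c < kap (crow c))%N.

(* Tableaux of all shapes contained in la are encoded on the same type, with
   the default value [ord0] outside of their shape. *)
Definition tab k kap (T : {ffun cell la -> 'I_N.+1}) :=
  [forall c, if in_shape kap c then (T c < k)%N else T c == ord0] &&
  [forall a, forall b, in_shape kap a && in_shape kap b ==>
     (((crow a == crow b) && (ccol a < ccol b)%N ==> (T a <= T b)%N) &&
      ((ccol a == ccol b) && (crow a < crow b)%N ==> (T a < T b)%N))].

Definition tabsum k kap : R :=
  \sum_(T | tab k kap T) \prod_(c | in_shape kap c) x (T c).

Lemma tabP k kap (T : {ffun cell la -> 'I_N.+1}) :
  reflect
    [/\ forall c, in_shape kap c -> (T c < k)%N,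
        forall c, ~~ in_shape kap c -> T c = ord0,
        forall a b, in_shape kap a -> in_shape kap b -> crow a = crow b ->
          (ccol a <= ccol b)%N -> (T a <= T b)%N &
        forall a b, in_shape kap a -> in_shape kap b -> ccol a = ccol b ->
          (crow a < crow b)%N -> (T a < T b)%N]
    (tab k kap T).
Proof.
apply: (iffP andP) => [[/forallP H1 /forallP H2]|[H1 H2 H3 H4]]; last first.
  split; first by apply/forallP => c; case: ifPn => [/H1|/H2->].
  apply/forallP => a; apply/forallP => b; apply/implyP => /andP[ha hb].
  apply/andP; split; apply/implyP => /andP[/eqP E lt]; first by rewrite H3 // ltnW.
  by rewrite H4.
split=> [c hc|c hc|a b ha hb E|a b ha hb E lt].
- by have := H1 c; rewrite hc.
- by have := H1 c; rewrite (negPf hc) => /eqP.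
- rewrite leq_eqVlt => /orP[/eqP F|lt]; first by rewrite (cell_inj E F).
  move/forallP: (H2 a) => /(_ b); rewrite ha hb E eqxx /= => /andP[/implyP-> //].
- move/forallP: (H2 a) => /(_ b); rewrite ha hb E eqxx /= => /andP[_ /implyP-> //].
Qed.

Definition sub_la (kap : nat -> nat) := forall j, (kap j <= nth 0%N la j)%N.

(** Columns increase strictly, so each step down from the top row raises the entry by at least one.
    Hence entries below [k] occur only in the first [k] rows. *)
Lemma tab_crow k kap T c : noninc kap -> sub_la kap -> tab k kap T ->
  in_shape kap c -> (crow c <= T c)%N.
Proof.
move=> kapP kap_la /tabP[_ _ _ H].
move Ei: (crow c) => i; elim: i c Ei => [//|i IH] c Ec hc.
have := hc; rewrite {1}/in_shape Ec => lt_c.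
have lt_c' := leq_trans lt_c (kapP i).
have [d [Ed Fd]] := cell_exists (leq_trans lt_c' (kap_la i)).
have hd : in_shape kap d by rewrite /in_shape Ed Fd.
by apply: leq_ltn_trans (IH d Ed hd) (H d c hd hc Fd _); rewrite Ed Ec.
Qed.

Lemma tabsum0 kap : (forall j, kap j = 0%N) -> tabsum 0 kap = 1.
Proof.
move=> kap0; have out c : in_shape kap c = false by rewrite /in_shape kap0.
rewrite /tabsum (big_pred1 [ffun=> ord0]) => [|T].
  by rewrite big_pred0.
apply/tabP/eqP => [[_ H _ _]|->].
  by apply/ffunP => c; rewrite ffunE H ?out.
by split=> [c|c _|a b|a b]; rewrite ?ffunE ?out.
Qed.

Lemma prod_ord_trunc (F : nat -> R) m n :
  (forall j, (m <= j)%N -> F j = 1) -> (m <= n)%N ->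
  \prod_(j < n) F j = \prod_(j < m) F j.
Proof.
move=> F1 le_mn; rewrite -!(big_mkord xpredT) (big_cat_nat _ (n := m)) //=.
rewrite [X in _ * X]big_nat_cond [X in _ * X]big1 ?mulr1 // => j.
by rewrite andbT => /andP[/F1].
Qed.

Lemma prod_strip (y : R) m (f g : nat -> nat) :
  (forall j, (m <= j)%N -> f j = 0%N) -> sub_la f ->
  \prod_(c : cell la | in_shape f c && ~~ in_shape g c) y =
  \prod_(j < m) y ^+ (f j - g j).
Proof.
move=> f_out f_la.
have -> : \prod_(j < m) y ^+ (f j - g j) =
          \prod_(j < size la) y ^+ (f j - g j).
  have [le|/ltnW le] := leqP m (size la).
    rewrite [RHS](@prod_ord_trunc (fun j => y ^+ (f j - g j)) m) // => j le_j.
    by rewrite f_out.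
  apply: (@prod_ord_trunc (fun j => y ^+ (f j - g j))) => // j le_j.
  by have := f_la j; rewrite nth_default // leqn0 => /eqP->.
rewrite /cell big_mkcond /=.
pose F (p : 'I_(size la) * 'I_(head 0%N la)) :=
  if (p.2 < f p.1)%N && ~~ (p.2 < g p.1)%N then y else 1.
transitivity (\prod_(p | in_diag la p) F p); first exact/esym/big_sub.
rewrite /F -big_mkcondr /=.
transitivity (\prod_(i < size la)
   \prod_(j < head 0%N la | (g i <= j < f i)%N) y).
  rewrite pair_big_dep /=; apply: eq_bigl => -[i j] /=.
  rewrite /in_mem /= /in_diag /=; have := f_la i; lia.
apply: eq_bigr => i _.
rewrite -(big_mkord (fun j => (g i <= j < f i)%N) (fun=> y)).
have le_f : (f i <= head 0 la)%N.
  by rewrite -nth0; apply: leq_trans (f_la i) _; apply: noninc_leq.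
have [le_fg|lt_gf] := leqP (f i) (g i).
  rewrite big_pred0 => [|j]; last by lia.
  by move: le_fg; rewrite -subn_eq0 => /eqP->.
rewrite -prodr_const_nat [RHS](big_nat_widenl _ 0%N) //.
by rewrite [RHS](big_nat_widen _ _ (head 0%N la)).
Qed.

(** * Removing the largest entry of a tableau *)

Section Branching.
Variables (C k : nat) (kap : nat -> nat).
Implicit Types (f : {ffun 'I_k -> 'I_C.+1}) (T : {ffun cell la -> 'I_N.+1}).
Hypotheses (kapP : noninc kap) (kap_la : sub_la kap) (kapC : (kap 0 <= C)%N).
Hypotheses (kap_out : kap k.+1 = 0%N) (lt_kN : (k < N.+1)%N).

(** Entries below [k] are left-justified in each row, so the length of their segment is the last
    column index plus one; the empty maximum gives 0 for a row without such entries. *)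
Definition subtab_shape (T : {ffun cell la -> 'I_N.+1}) : {ffun 'I_k -> 'I_C.+1} :=
  [ffun j : 'I_k =>
     inord (\max_(c | [&& crow c == j, in_shape kap c & (T c < k)%N]) (ccol c).+1)].

Lemma subtab_shapeE T c : tab k.+1 kap T -> in_shape kap c ->
  in_shape (shape_of (subtab_shape T)) c = (T c < k)%N.
Proof.
move=> TP hc; have le_cT := tab_crow kapP kap_la TP hc.
rewrite /in_shape; have [lt_ck|] := ltnP (crow c) k; last first.
  move=> le_kc; rewrite shape_of_out // ltn0; apply/esym/negbTE; rewrite -leqNgt.
  exact: leq_trans le_cT.
rewrite -[crow c]/(val (Ordinal lt_ck)) shape_ofE ffunE inordK; last first.
  rewrite ltnS; apply/bigmax_leqP => d /and3P[_ hd _].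
  apply: leq_trans hd _; apply: leq_trans kapC; exact: noninc_leq.
apply/idP/idP => [|lt_T]; last first.
  by apply: leq_bigmax_cond; rewrite eqxx hc.
apply: contraTT; rewrite -leqNgt => le_kT; rewrite -leqNgt.
apply/bigmax_leqP => d /and3P[/eqP Ed hd lt_dk]; rewrite ltnNge.
apply: contraTN lt_dk => le_cd; rewrite -leqNgt; apply: leq_trans le_kT _.
by case/tabP: TP => _ _ H _; apply: H.
Qed.

(** For the lower bound, the last cell of row [j.+1] has an entry at most [k], so the cell above it
    has an entry below [k]. *)
Lemma subtab_shape_interlace T : tab k.+1 kap T -> interlace kap (subtab_shape T).
Proof.
move=> TP; apply/interlaceP => j lt_jk; apply/andP; split.
  case Ek : (kap j.+1) => [//|q].
  have lt_q : (q < kap j.+1)%N by rewrite Ek.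
  have [d [Ed Fd]] := cell_exists (leq_trans lt_q (kap_la _)).
  have lt_q' := leq_trans lt_q (kapP j).
  have [c [Ec Fc]] := cell_exists (leq_trans lt_q' (kap_la _)).
  have hd : in_shape kap d by rewrite /in_shape Ed Fd.
  have hc : in_shape kap c by rewrite /in_shape Ec Fc.
  have := subtab_shapeE TP hc; rewrite {1}/in_shape Ec Fc => ->.
  case/tabP: TP => H1 _ _ H4; rewrite -ltnS; apply: leq_trans (H1 d hd).
  by rewrite ltnS; apply: H4; rewrite ?Fc ?Fd ?Ec ?Ed.
have le_m : (\max_(c | [&& crow c == j, in_shape kap c & (T c < k)%N])
   (ccol c).+1 <= kap j)%N.
  by apply/bigmax_leqP => d /and3P[/eqP <- hd _].
rewrite -[X in shape_of _ X]/(val (Ordinal lt_jk)) shape_ofE ffunE inordK //.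
by rewrite ltnS; apply: leq_trans le_m _; apply: leq_trans kapC; exact: noninc_leq.
Qed.

Definition subtab (f : {ffun 'I_k -> 'I_C.+1}) (T : {ffun cell la -> 'I_N.+1}) :=
  [ffun c => if in_shape (shape_of f) c then T c else ord0].

(** The inverse of [subtab]: every cell of the strip receives the largest entry [k]. *)
Definition suptab (f : {ffun 'I_k -> 'I_C.+1}) (T : {ffun cell la -> 'I_N.+1}) :=
  [ffun c => if in_shape (shape_of f) c then T c
             else if in_shape kap c then inord k else ord0].

Lemma in_shape_sub f c : interlace kap f ->
  in_shape (shape_of f) c -> in_shape kap c.
Proof.
move=> /interlaceP Hf; rewrite /in_shape.
have [lt_ck|/shape_of_out-> //] := ltnP (crow c) k.
by case/andP: (Hf _ lt_ck) => _ le /leq_trans; apply.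
Qed.

Lemma suptabK f T : interlace kap f -> tab k.+1 kap T -> subtab_shape T = f ->
  suptab f (subtab f T) = T.
Proof.
move=> Hf TP Ef; apply/ffunP => c; rewrite !ffunE.
have [//|hc] := boolP (in_shape (shape_of f) c); case: ifPn => hk; last first.
  by case/tabP: TP => _ -> .
apply: val_inj; rewrite /= inordK //; apply/eqP; rewrite eqn_leq.
case/tabP: (TP) => H _ _ _; rewrite -[X in _ && X]ltnS H // andbT.
by move: hc; rewrite -Ef subtab_shapeE // -leqNgt.
Qed.

Lemma suptab_tab f T : interlace kap f -> tab k (shape_of f) T ->
  tab k.+1 kap (suptab f T).
Proof.
move=> Hf TP; have [H1 H2 H3 H4] := tabP _ _ _ TP.
have fP := interlace_noninc Hf.
apply/tabP; split=> [c hc|c hc|a b ha hb Er le_ab|a b ha hb Ec lt_ab]; rewrite !ffunE.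
- case: ifPn => [/H1 /leqW //|_]; by rewrite hc inordK.
- rewrite (negPf hc); case: ifPn => // /(in_shape_sub Hf) hk.
  by rewrite hk in hc.
- rewrite ha hb; case: (boolP (in_shape _ a)) => ha'; case: (boolP (in_shape _ b)) => hb' //.
  + exact: H3.
  + by rewrite inordK // ltnW // H1.
  + case/negP: ha'; rewrite /in_shape Er; exact: leq_ltn_trans le_ab hb'.
- rewrite ha hb.
  (* Interlacing makes the strip horizontal: a cell with another cell of [kap] below it in its
     column lies in the inner shape. *)
  have ha' : in_shape (shape_of f) a.
    have lt_k : (crow a < k)%N.
      rewrite ltnNge; apply/negP => le_k; move: hb; rewrite /in_shape ltnNge.
      case/negP; rewrite -[X in (_ <= X)%N]add0n -[X in (X <= _)%N]add0n.
      by apply: leq_trans (noninc_leq kapP (_ : (k.+1 <= crow b)%N)) _;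
        rewrite ?kap_out //; apply: leq_ltn_trans lt_ab.
    rewrite /in_shape Ec; case/andP: (interlaceP _ _ Hf _ lt_k) => le _.
    apply: leq_trans le; apply: leq_trans hb _; exact: noninc_leq.
  rewrite ha'; case: ifPn => hb'; first exact: H4.
  by rewrite inordK // H1.
Qed.

Lemma subtab_tab f T : interlace kap f -> tab k.+1 kap T -> subtab_shape T = f ->
  tab k (shape_of f) (subtab f T).
Proof.
move=> Hf TP Ef; have [H1 H2 H3 H4] := tabP _ _ _ TP.
apply/tabP; split=> [c hc|c /negPf hc|a b ha hb Er le_ab|a b ha hb Ec lt_ab]; rewrite !ffunE.
- rewrite hc -subtab_shapeE ?Ef //; exact: in_shape_sub hc.
- by rewrite hc.
- by rewrite ha hb; apply: H3 => //; apply: in_shape_sub Hf _.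
- by rewrite ha hb; apply: H4 => //; apply: in_shape_sub Hf _.
Qed.

Lemma suptab_shape f T : interlace kap f -> tab k (shape_of f) T ->
  subtab_shape (suptab f T) = f.
Proof.
move=> Hf TP; have [H1 H2 H3 H4] := tabP _ _ _ TP.
have UP := suptab_tab Hf TP.
have E c : in_shape kap c -> in_shape (shape_of (subtab_shape (suptab f T))) c =
    in_shape (shape_of f) c.
  move=> hc; rewrite subtab_shapeE // !ffunE hc; case: ifPn => [/H1 //|_].
  by rewrite inordK // ltnn.
have le_fk (g : {ffun 'I_k -> 'I_C.+1}) (j : 'I_k) : interlace kap g -> (g j <= kap j)%N.
  by move/interlaceP => /(_ j (ltn_ord j)) /andP[_]; rewrite shape_ofE.
(* Comparing cells in both directions identifies two interlacing shapes. *)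
have le (g h : {ffun 'I_k -> 'I_C.+1}) : interlace kap g ->
    (forall c, in_shape kap c -> in_shape (shape_of g) c -> in_shape (shape_of h) c) ->
    forall j : 'I_k, (g j <= h j)%N.
  move=> Hg sub_gh j; case Eg: (g j : nat) => [//|q].
  have lt_q : (q < kap j)%N by rewrite -Eg le_fk.
  have [c [Ec Fc]] := cell_exists (leq_trans lt_q (kap_la _)).
  have := sub_gh c; rewrite /in_shape Ec Fc !shape_ofE Eg; exact.
apply/ffunP => j; apply: val_inj; apply/eqP; rewrite /= eqn_leq.
rewrite !le // => [c /E<- //||c /E-> //]; exact: subtab_shape_interlace.
Qed.

(** Tableaux are grouped by the shape of their entries below [k]; the other cells all contribute
    [x k]. This is the recursion that defines [gtsum]. *)
Lemma tabsumS :
  tabsum k.+1 kap =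
  \sum_(f : {ffun 'I_k -> 'I_C.+1} | interlace kap f)
    (\prod_(j < k) x k ^+ (kap j - f j)) * x k ^+ kap k * tabsum k (shape_of f).
Proof.
rewrite /tabsum (partition_big subtab_shape (@interlace k C kap)) /=; last first.
  exact: subtab_shape_interlace.
apply: eq_bigr => f Hf.
rewrite (reindex_onto (suptab f) (subtab f)); last first.
  by move=> T /andP[TP /eqP Ef]; apply: suptabK.
rewrite mulr_sumr; apply: eq_big => [T|T /andP[/andP[UP /eqP Ef] /eqP ET]].
  apply/idP/idP => [/andP[/andP[UP /eqP Ef] /eqP <-]|TP].
    exact: subtab_tab.
  rewrite suptab_tab // suptab_shape // eqxx /=; apply/eqP/ffunP => c.
  rewrite !ffunE; have [//|hc] := boolP (in_shape (shape_of f) c).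
  by case/tabP: TP => _ ->.
rewrite (bigID (in_shape (shape_of f))) /= mulrC; congr (_ * _).
  rewrite (eq_bigr (fun=> x k)); last first.
    by move=> c /andP[hc /negPf hf]; rewrite ffunE hf hc inordK.
  rewrite (@prod_strip _ k.+1) // => [|j le_j].
    rewrite big_ord_recr /= (shape_of_out _ (leqnn k)) subn0; congr (_ * _).
    by apply: eq_bigr => j _; rewrite shape_ofE.
  by apply/eqP; rewrite -leqn0 -kap_out noninc_leq.
apply: eq_big => [c|c /andP[_ hc]]; last by rewrite ffunE hc.
by case: (boolP (in_shape (shape_of f) c)) => [/(in_shape_sub Hf)->|]; rewrite ?andbF.
Qed.

End Branching.
Lemma tabsum_gtsum C k kap : noninc kap -> sub_la kap -> (kap 0 <= C)%N ->
  kap k = 0%N -> (k <= N.+1)%N -> tabsum k kap = gtsum C x k kap.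
Proof.
elim: k kap => [|k IH] kap kapP kap_la kapC kap_out le_kN.
  by rewrite tabsum0 // => j; apply/eqP; rewrite -leqn0 -kap_out noninc_leq.
rewrite (@tabsumS C) //=; apply: eq_bigr => f Hf; congr (_ * _).
apply: IH; rewrite ?shape_of_leq ?shape_of_out //; last exact: ltnW.
  exact: interlace_noninc Hf.
move=> j; have [lt_jk|/shape_of_out-> //] := ltnP j k.
by case/andP: (interlaceP _ _ Hf _ lt_jk) => _ /leq_trans; apply.
Qed.

End Tableaux.

(* The Schur polynomial, evaluated at x 0, ..., x N. *)
Lemma schur_eval (R : comNzRingType) (N C : nat) (la : seq nat) (x : nat -> R)
    (phi : {rmorphism {mpoly rat[N.+1]} -> R}) :
  is_part la -> (size la <= N.+1)%N -> (nth 0%N la 0 <= C)%N ->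
  (forall i : 'I_N.+1, phi 'X_i = x i) ->
  phi (schur N.+1 la) = gtsum C x N.+1 (nth 0%N la).
Proof.
move=> laP le_N laC phiE.
have la_in (c : cell la) : in_shape (nth 0%N la) c by apply: ccolP.
rewrite -(@tabsum_gtsum _ _ la N laP) //; last by rewrite nth_default.
  rewrite /schur rmorph_sum /tabsum; apply: eq_big => [T|T _].
    rewrite /tab /is_ssyt.
    have -> : [forall c, if in_shape (nth 0%N la) c then (T c < N.+1)%N else T c == ord0].
      by apply/forallP => c; rewrite la_in ltn_ord.
    by apply: eq_forallb => a; apply: eq_forallb => b; rewrite !la_in.
  rewrite rmorph_prod; apply: eq_big => [c|c _]; first by rewrite la_in.
  exact: phiE.
exact: part_noninc.
Qed.

(** * Nilpotent evaluations *)

(** Ideals are [Prop]-valued because those used below are given by conditions on infinitely many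
    coefficients. *)
Record ideal_pred (A : comNzRingType) (I : A -> Prop) : Prop := IdealPred {
  ideal0 : I 0;
  idealD : forall a b, I a -> I b -> I (a + b);
  idealMl : forall a b, I b -> I (a * b)
}.

Section Ideals.
Variables (A : comNzRingType) (I : A -> Prop).
Hypothesis idI : ideal_pred I.

Lemma idealMr a b : I a -> I (a * b).
Proof. by rewrite mulrC; apply: idealMl. Qed.

Lemma idealN a : I a -> I (- a).
Proof. by move=> Ia; rewrite -mulN1r; apply: idealMl. Qed.

Lemma ideal_sum (J : Type) (r : seq J) (P : pred J) (F : J -> A) :
  (forall j, P j -> I (F j)) -> I (\sum_(j <- r | P j) F j).
Proof. by move=> IF; elim/big_ind: _ => //; [apply: ideal0 | apply: idealD]. Qed.

Lemma ideal_prodB (J : Type) (r : seq J) (F G : J -> A) :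
  (forall j, I (F j - G j)) -> I (\prod_(j <- r) F j - \prod_(j <- r) G j).
Proof.
move=> IFG; elim: r => [|j r IH]; first by rewrite !big_nil subrr; apply: ideal0.
rewrite !big_cons.
have -> : F j * \prod_(i <- r) F i - G j * \prod_(i <- r) G i =
  F j * (\prod_(i <- r) F i - \prod_(i <- r) G i) +
  (F j - G j) * \prod_(i <- r) G i by ring.
by apply: idealD => //; [apply: idealMl | apply: idealMr].
Qed.

Lemma ideal_detB k (B C : 'M[A]_k) :
  (forall i j, I (B i j - C i j)) -> I (\det B - \det C).
Proof.
move=> IBC; rewrite /determinant -sumrB; apply: ideal_sum => s _.
by rewrite -mulrBr; apply: idealMl => //; apply: ideal_prodB.
Qed.

Lemma ideal_det_col k (B : 'M[A]_k) j : (forall i, I (B i j)) -> I (\det B).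
Proof.
move=> IB; rewrite (expand_det_col _ j); apply: ideal_sum => i _.
exact: idealMr.
Qed.

Definition poly_ideal (p : {poly A}) : Prop := forall i, I p`_i.

Lemma poly_idealP : ideal_pred poly_ideal.
Proof.
split=> [i|p q Ip Iq i|p q Iq i]; rewrite ?coef0 ?coefD ?coefM.
- exact: ideal0.
- exact: idealD.
- by apply: ideal_sum => j _; apply: idealMl.
Qed.

(** Division by a monic polynomial is linear over [A]: the remainder of [p] combines remainders of
    powers of the variable, with coefficients in [I]. *)
Lemma poly_ideal_rmodp (p d : {poly A}) : d \is monic ->
  poly_ideal p -> poly_ideal (Pdiv.CommonRing.rmodp p d).
Proof.
move=> d_monic Ip; rewrite -[p]coefK poly_def Pdiv.RingMonic.rmodp_sum //.
elim/big_ind: _ => [i|q r Iq Ir i|j _ i].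
- by rewrite coef0; apply: ideal0.
- by rewrite coefD; apply: idealD.
- by rewrite Pdiv.RingMonic.rmodpZ // coefZ; apply: idealMr.
Qed.

Lemma ideal_transporter v : ideal_pred (fun a => I (a * v)).
Proof.
split=> [|a b Ia Ib|a b Ib]; first by rewrite mul0r; apply: ideal0.
  by rewrite mulrDl; apply: idealD.
by rewrite -mulrA; apply: idealMl.
Qed.

End Ideals.

Section NilpotentAlternant.
Variables (A : comNzRingType) (I : A -> Prop) (w : nat -> A) (p n : nat).
Hypothesis idI : ideal_pred I.
Hypothesis n_gt0 : (0 < n)%N.
Hypothesis w_nil : forall i e, (i < p)%N -> (p <= e)%N -> I (w i ^+ e).

(* Modulo I, multiplying the rows of the Vandermonde matrix by t - w_i^n amounts
   to multiplying it on the right by the matrix of t - tau^n acting on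
   A[tau]/(tau^p), which is triangular with determinant t^p. *)
Lemma vdm_kills_symmetric :
  poly_ideal I ((vdm w 0 p)%:P * (\prod_(i < p) ('X - (w i ^+ n)%:P) - 'X^p)).
Proof.
pose U0 : 'M[A]_p := \matrix_(i, l) w i ^+ (0 + (p.-1 - l)).
have detU0 : \det U0 = vdm w 0 p.
  by have := @alternant_gtsum _ 0 w p (fun=> 0%N); rewrite gtsum0 mulr1; apply.
pose U := map_mx polyC U0.
pose L : 'M[{poly A}]_p := \matrix_(i, j)
  ((i == j)%:R * 'X - (p.-1 - i == n + (p.-1 - j))%N%:R).
have detL : \det L = 'X^p.
  rewrite -det_tr det_trig.
    rewrite (eq_bigr (fun=> 'X)) ?prodr_const ?card_ord // => i _.
    rewrite !mxE eqxx mul1r -[X in X == _]add0n eqn_add2r.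
    by rewrite ltn_eqF // subr0.
  apply/forallP => i; apply/forallP => j; apply/implyP => lt_ij.
  rewrite !mxE; have -> : (j == i) = false by apply/negbTE; rewrite neq_ltn lt_ij orbT.
  rewrite mul0r sub0r oppr_eq0 ltn_eqF //.
  by have := ltn_ord j; lia.
have -> : (vdm w 0 p)%:P * (\prod_(i < p) ('X - (w i ^+ n)%:P) - 'X^p) =
  \det (diag_mx (\row_i ('X - (w i ^+ n)%:P)) *m U) - \det (U *m L).
  rewrite !det_mulmx det_diag detL det_map_mx detU0 mulrBr mulrC.
  by congr (_ * _ - _); apply: eq_bigr => i _; rewrite mxE.
apply: (ideal_detB (poly_idealP idI)) => i j.
rewrite mul_diag_mx !mxE add0n.
(* The product by [tau^n] has exponent [n + (p.-1 - j)], which is below [p] exactly when [n <= j].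
   Otherwise [L] drops the term, and the discrepancy is a power of [w i] lying in [I]. *)
have -> : \sum_k U i k * L k j = (w i ^+ (p.-1 - j))%:P * 'X -
  (if (n <= j)%N then (w i ^+ (n + (p.-1 - j)))%:P else 0).
  under eq_bigr => k _ do rewrite !mxE mulrBr add0n.
  rewrite sumrB (bigD1 j) //= eqxx mul1r big1 ?addr0; last first.
    by move=> k /negPf->; rewrite mul0r mulr0.
  congr (_ - _); have lt_jp := ltn_ord j; case: leqP => [le_nj|lt_jn]; last first.
    apply: big1 => k _; case: (_ =P (n + (p.-1 - j))%N) => [E|]; last by rewrite mulr0.
    by have := ltn_ord k; lia.
  have lt_p : (j - n < p)%N by lia.
  rewrite (bigD1 (Ordinal lt_p)) //= big1 ?addr0 => [|k Hk].
    have -> : (p.-1 - (j - n) = n + (p.-1 - j))%N by lia.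
    by rewrite eqxx mulr1.
  case: (_ =P (n + (p.-1 - j))%N) => [E|]; last by rewrite mulr0.
  case/eqP: Hk; apply: val_inj => /=; have := ltn_ord k; lia.
rewrite mulrBl -polyCM -exprD ['X * _]mulrC.
case: leqP => [_|lt_jn]; first by rewrite subrr => q; rewrite coef0; apply: (ideal0 idI).
rewrite subr0 addrAC subrr sub0r; apply: (idealN (poly_idealP idI)).
move=> q; rewrite coefC; case: eqP => _; last exact: (ideal0 idI).
by apply: w_nil => //; have := ltn_ord j; lia.
Qed.

End NilpotentAlternant.

(** A power of [t] and its remainder modulo the product of the [t - u i] agree at each root [u i].
    So the alternant is the Vandermonde matrix times the matrix of remainder coefficients, and the
    Vandermonde factor cancels because the [u i] are distinct. *)
Lemma rmodp_det_gtsum (A : idomainType) C (u : nat -> A) M kap :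
  noninc kap -> (kap 0 <= C)%N ->
  (forall i j, (j < i)%N -> (i < M)%N -> u i != u j) ->
  gtsum C u M kap =
  \det (\matrix_(j < M, l < M)
    (Pdiv.CommonRing.rmodp ('X^(kap l + (M.-1 - l)))
       (\prod_(i < M) ('X - (u i)%:P)))`_(M.-1 - j)).
Proof.
move=> kapP kapC u_inj; set P := \prod_(i < M) _; set D := \matrix_(j, l) _.
have P_monic : P \is monic by apply: monic_prod => i _; apply: monicXsubC.
have sizeP : size P = M.+1 by rewrite size_prod_XsubC -sum1_size big_const_ord iter_addn_0 mul1n.
have vdm_neq0 : vdm u 0 M != 0.
  rewrite /vdm big_mkord; apply/prodf_neq0 => i _; apply/prodf_neq0 => j _.
  by rewrite subr_eq0 eq_sym u_inj.
apply: (mulfI vdm_neq0); rewrite -alternant_gtsum // /alternant.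
have -> : vdm u 0 M = alternant u M (fun=> 0%N).
  by rewrite (@alternant_gtsum _ 0) // gtsum0 mulr1.
rewrite /alternant -det_mulmx; congr determinant.
apply/matrixP => i l; rewrite !mxE.
set e := (_ + _)%N; set r := Pdiv.CommonRing.rmodp 'X^e P.
have Er : u i ^+ e = r.[u i].
  have := Pdiv.RingMonic.rdivp_eq P_monic 'X^e => /(congr1 (horner^~ (u i))).
  rewrite hornerXn hornerD hornerM => ->.
  suff -> : P.[u i] = 0 by rewrite mulr0 add0r.
  rewrite horner_prod (bigD1 i) //= hornerXsubC subrr mul0r //.
have size_r : (size r <= M)%N.
  by rewrite -ltnS -sizeP Pdiv.CommonRing.ltn_rmodpN0 // monic_neq0.
rewrite Er (horner_coef_wide _ size_r) (reindex_inj rev_ord_inj) /=.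
apply: eq_bigr => j _; rewrite !mxE mulrC add0n.
by have -> : (M - j.+1 = M.-1 - j)%N by lia.
Qed.

Section NilpotentGtsum.
Variables (A : idomainType) (I : A -> Prop) (w v : nat -> A) (M b n : nat).
Hypothesis idI : ideal_pred I.
Hypothesis n_gt0 : (0 < n)%N.
Hypothesis w_nil : forall i e, (i < M + b)%N -> (M + b <= e)%N -> I (w i ^+ e).
Hypothesis vw : forall i, (i < M)%N -> v i = w i ^+ n.
Hypothesis v_inj : forall i j, (j < i)%N -> (i < M)%N -> v i != v j.

Let T (a : A) := I (a * vdm w 0 (M + b)).

Let idT : ideal_pred T. Proof. exact: ideal_transporter. Qed.

(** By [vdm_kills_symmetric], [t^(M + b)] is congruent modulo [T] to [P * Q], where [Q] collects the
    [b] remaining variables. Hence [t^e] is congruent to a multiple of [P]. *)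
Lemma poly_ideal_rmodXn e : (M + b <= e)%N ->
  poly_ideal T (Pdiv.CommonRing.rmodp 'X^e (\prod_(i < M) ('X - (v i)%:P))).
Proof.
move=> le_e; set P := \prod_(i < M) _.
have P_monic : P \is monic by apply: monic_prod => i _; apply: monicXsubC.
pose Q := \prod_(M <= i < M + b) ('X - (w i ^+ n)%:P).
pose S := P * Q - 'X^(M + b).
have TS : poly_ideal T S.
  have := vdm_kills_symmetric idI n_gt0 w_nil.
  rewrite -(big_mkord xpredT (fun i => 'X - (w i ^+ n)%:P)).
  rewrite (big_cat_nat _ (n := M)) ?leq_addr //= big_mkord.
  rewrite -(eq_bigr _ (fun (i : 'I_M) _ => congr1 (fun a => 'X - a%:P) (vw (ltn_ord i)))).
  by move=> H i; have := H i; rewrite mulrC coefMC.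
have -> : 'X^e = ('X^(e - (M + b)) * Q) * P - 'X^(e - (M + b)) * S.
  rewrite /S mulrBr opprB -exprD subnK //; ring.
rewrite Pdiv.RingMonic.rmodpB // Pdiv.RingMonic.rmodp_mull // sub0r.
apply: (idealN (poly_idealP idT)).
apply: (poly_ideal_rmodp idT) => //; apply: (idealMl (poly_idealP idT)); exact: TS.
Qed.

(** For [j = 0] the first column of the determinant comes from exponent [kap 0 + M.-1], at least
    [M + b], so it lies in [T]. Peeling off one more variable replaces [kap] by an interlacing [f]
    with [f j >= kap j.+1 > b]. *)
Lemma ideal_gtsum C j kap : (0 < M)%N ->
  noninc kap -> (kap 0 <= C)%N -> (b < kap j)%N ->
  T (gtsum C v (M + j) kap).
Proof.
move=> M_gt0; elim: j kap => [|j IH] kap kapP kapC lt_b.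
  rewrite addn0 rmodp_det_gtsum //; apply: (ideal_det_col idT (j := Ordinal M_gt0)).
  move=> i; rewrite mxE; apply: poly_ideal_rmodXn => /=; lia.
rewrite addnS /=; apply: (ideal_sum idT) => f Hf.
apply: (idealMl idT); apply: IH; rewrite ?shape_of_leq //.
  exact: interlace_noninc Hf.
have lt_j : (j < M + j)%N by lia.
by case/andP: (interlaceP _ _ Hf _ lt_j) => le _; apply: leq_trans le.
Qed.

End NilpotentGtsum.

(** * Coefficient extraction *)

Section Coefficients.
Variable K : nat.
Implicit Types (f g : {mpoly rat[K]}) (m : 'X_{1..K}) (q : 'I_K).

(** The ideal generated by the [p]-th powers of the first [p] variables, described by
    coefficients. *)
Definition truncated p f :=
  forall m, (forall q, (q < p)%N -> (m q < p)%N) -> f@_m = 0.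

Lemma truncated_ideal p : ideal_pred (truncated p).
Proof.
split=> [m _|f g Hf Hg m Hm|f g Hg m Hm]; first exact: mcoeff0.
  by rewrite mcoeffD Hf ?Hg ?addr0.
rewrite mcoeffM big1 // => k /eqP Em; rewrite Hg ?mulr0 // => q lt_q.
apply: leq_ltn_trans (Hm q lt_q); move/mnmP: Em => /(_ q) ->.
by rewrite mnmDE leq_addl.
Qed.

Lemma truncated_Xn p q e : (q < p)%N -> (p <= e)%N -> truncated p ('X_q ^+ e).
Proof.
move=> lt_q le_e m Hm; rewrite mcoeffXn; case: eqP => // Em.
by have := Hm q lt_q; rewrite -Em mulmnE mnm1E eqxx mul1n ltnNge le_e.
Qed.

Definition deg_le q r f := forall m, (r < m q)%N -> f@_m = 0.

Lemma deg_leM q r s f g : deg_le q r f -> deg_le q s g -> deg_le q (r + s) (f * g).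
Proof.
move=> Hf Hg m lt_m; rewrite mcoeffM big1 // => k /eqP Em.
have [/Hf->|le_r] := ltnP r (k.1 q); first by rewrite mul0r.
have [/Hg->|le_s] := ltnP s (k.2 q); first by rewrite mulr0.
by move: lt_m; move/mnmP: Em => /(_ q) ->; rewrite mnmDE ltnNge leq_add.
Qed.

Lemma deg_leB q r f g : deg_le q r f -> deg_le q r g -> deg_le q r (f - g).
Proof. by move=> Hf Hg m Hm; rewrite mcoeffB Hf ?Hg ?subrr. Qed.

Lemma deg_leX q j : deg_le q (j == q) 'X_j.
Proof.
move=> m lt_m; rewrite mcoeffX; case: eqP => // Em.
by move: lt_m; rewrite -Em mnm1E ltnn.
Qed.

Lemma deg_le_leq q r s f : (r <= s)%N -> deg_le q r f -> deg_le q s f.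
Proof. by move=> le_rs Hf m /(leq_ltn_trans le_rs)/Hf. Qed.

(** The top power of ['X_q] arises only by taking [- 'X_q] in every factor. The degree bound is
    proved jointly since the induction uses it. *)
Lemma mcoeff_prod_subX (r : nat) (h : 'I_r -> 'I_K) q f m :
  (forall j, h j != q) -> deg_le q 0 f -> m q = 0%N ->
  deg_le q r (f * \prod_(j < r) ('X_(h j) - 'X_q)) /\
  (f * \prod_(j < r) ('X_(h j) - 'X_q))@_(m + U_(q) *+ r) = (-1) ^+ r * f@_m.
Proof.
elim: r h => [|r IH] h hq Hf m0.
  by rewrite big_ord0 mulr1 mulm0n addm0 mul1r.
rewrite big_ord_recr mulrA /=.
have [|D E] := IH (fun j => h (widen_ord (leqnSn r) j)) _ Hf m0.
  by move=> j; apply: hq.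
set G := f * _ in D E *; split.
  rewrite -addn1; apply: deg_leM => //; apply: deg_leB; last first.
    by have := @deg_leX q q; rewrite eqxx.
  by apply: (@deg_le_leq _ 0) => //; have := @deg_leX q (h ord_max); rewrite (negPf (hq _)).
rewrite mulrBr mcoeffB.
have -> : (G * 'X_(h ord_max))@_(m + U_(q) *+ r.+1) = 0.
  have /(deg_leM D) := @deg_leX q (h ord_max); rewrite (negPf (hq _)) addn0; apply.
  by rewrite mnmDE mulmnE mnm1E eqxx m0 mul1n.
have -> : (m + U_(q) *+ r.+1 = U_(q) + (m + U_(q) *+ r))%MM.
  by apply/mnmP => o; rewrite !mnmDE !mulmnE; lia.
by rewrite mcoeffMX E sub0r exprS mulN1r mulNr.
Qed.

Lemma deg_le0_prod q (J : Type) (r : seq J) (P : pred J) (F : J -> {mpoly rat[K]}) :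
  (forall j, P j -> deg_le q 0 (F j)) -> deg_le q 0 (\prod_(j <- r | P j) F j).
Proof.
move=> HF; elim/big_ind: _ => // [m|f g]; last exact: deg_leM.
by rewrite mcoeff1; case: eqP => // ->; rewrite mnm0E.
Qed.

(** The variables [h q] with [M <= q < p] are absent from [f] and [m]. Extracting the top power of
    each, the last one first, contributes a sign; only its being nonzero matters later. *)
Lemma mcoeff_vdm (w : nat -> {mpoly rat[K]}) (h : nat -> 'I_K) M p f m :
  (M <= p)%N -> (forall j, (j < p)%N -> w j = 'X_(h j)) ->
  (forall i j, (j < i)%N -> (i < p)%N -> h j != h i) ->
  (forall q : nat, (M <= q < p)%N -> deg_le (h q) 0 f /\ m (h q) = 0%N) ->
  exists2 eps : rat, eps != 0 &
    (f * vdm w M p)@_(m + \sum_(M <= q < p) U_(h q) *+ q) = eps * f@_m.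
Proof.
elim: p => [|p IH].
  rewrite leqn0 => /eqP-> _ _ _; exists 1; rewrite ?oner_eq0 //.
  by rewrite /vdm !big_geq // mulr1 addm0 mul1r.
rewrite leq_eqVlt => /predU1P[->|].
  move=> _ _ _; exists 1; rewrite ?oner_eq0 //.
  by rewrite /vdm !big_geq // mulr1 addm0 mul1r.
rewrite ltnS => le_Mp wE h_inj Hq.
have [|||eps eps0 E] := IH le_Mp.
- by move=> j lt_j; apply: wE; apply: ltnW.
- by move=> i j lt_j lt_i; apply: h_inj => //; apply: ltnW.
- by move=> q /andP[le_q lt_q]; apply: Hq; rewrite le_q ltnW.
have [|Hf0 m0] := Hq p; first by rewrite le_Mp ltnSn.
have -> : vdm w M p.+1 = vdm w M p * \prod_(j < p) (w j - w p).
  by rewrite /vdm big_nat_recr.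
rewrite mulrA.
have D : deg_le (h p) 0 (f * vdm w M p).
  apply: (@deg_leM _ 0 0) => //; rewrite /vdm big_nat_cond.
  apply: deg_le0_prod => i; rewrite andbT => /andP[_ lt_ip].
  apply: deg_le0_prod => j _; have lt_jp := ltn_trans (ltn_ord j) lt_ip.
  rewrite !wE ?(leqW lt_ip) ?(leqW lt_jp) //.
  have Dj k : (k < p)%N -> deg_le (h p) 0 'X_(h k).
    by move=> lt_k; have := @deg_leX (h p) (h k); rewrite (negPf (h_inj _ _ lt_k _)).
  by apply: deg_leB; apply: Dj.
exists ((-1) ^+ p * eps); first by rewrite mulf_neq0 // signr_eq0.
rewrite big_nat_recr //= addmA.
have -> : \prod_(j < p) (w j - w p) = \prod_(j < p) ('X_(h j) - 'X_(h p)).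
  by apply: eq_bigr => j _; rewrite !wE // leqW.
have [||_ ->] := @mcoeff_prod_subX p h (h p) _ (m + \sum_(M <= q < p) U_(h q) *+ q)%MM _ D.
- by move=> j; apply: h_inj.
- rewrite mnmDE m0 mnm_sumE big_nat_cond big1 // => q; rewrite andbT => /andP[_ lt_q].
  by rewrite mulmnE mnm1E (negPf (h_inj _ _ lt_q _)).
by rewrite E mulrA.
Qed.

(** * Monomials of alternants *)

Definition staircase (N : nat) (kap : nat -> nat) (l : nat) := (kap l + (N.-1 - l))%N.

Definition mon N (g : 'I_N -> 'I_K) (e : 'I_N -> nat) : 'X_{1..K} :=
  (\sum_(i < N) U_(g i) *+ e i)%MM.

Lemma monE N (g : 'I_N -> 'I_K) e i : injective g -> mon g e (g i) = e i.
Proof.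
move=> g_inj; rewrite /mon mnm_sumE (bigD1 i) //= mulmnE mnm1E eqxx mul1n.
rewrite big1 ?addn0 // => j /negPf ne_ji.
by rewrite mulmnE mnm1E (inj_eq g_inj) ne_ji.
Qed.

Lemma mon_out N (g : 'I_N -> 'I_K) e q : (forall i, g i != q) -> mon g e q = 0%N.
Proof.
move=> gq; rewrite /mon mnm_sumE big1 // => j _.
by rewrite mulmnE mnm1E (negPf (gq j)).
Qed.

Lemma alternantE N (v : nat -> {mpoly rat[K]}) (g : 'I_N -> 'I_K) kap :
  (forall i : 'I_N, v i = 'X_(g i)) ->
  alternant v N kap =
  \sum_(s : 'S_N) (-1) ^+ s * 'X_[mon g (fun i => staircase N kap (s i))].
Proof.
move=> vE; rewrite /alternant /determinant; apply: eq_bigr => s _; congr (_ * _).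
rewrite -mprodXE; apply: eq_bigr => i _.
by rewrite mxE vE mpolyXn.
Qed.

Lemma staircase_decr N kap i j : noninc kap ->
  (i < j)%N -> (j < N)%N -> (staircase N kap j < staircase N kap i)%N.
Proof.
move=> kapP lt_ij lt_j; rewrite /staircase.
by have := noninc_leq kapP (ltnW lt_ij); lia.
Qed.

Lemma staircase_inj N kap (i j : 'I_N) : noninc kap ->
  staircase N kap i = staircase N kap j -> i = j.
Proof.
move=> kapP E; apply: val_inj; case: (ltngtP i j) => // lt_ij.
  by have := staircase_decr kapP lt_ij (ltn_ord j); rewrite E ltnn.
by have := staircase_decr kapP lt_ij (ltn_ord i); rewrite E ltnn.
Qed.

(** The two staircases are strictly decreasing and have the same set of values, hence coincide. *)
Lemma staircase_perm_eq N kap kap' (s t : 'S_N) : noninc kap -> noninc kap' ->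
  (forall i, staircase N kap (s i) = staircase N kap' (t i)) ->
  forall j, (j < N)%N -> kap j = kap' j.
Proof.
move=> kapP kapP' Est.
have sorted_sc k : noninc k -> sorted gtn [seq staircase N k l | l <- iota 0 N].
  move=> kP; rewrite sorted_map.
  apply: (@sub_in_sorted _ (mem (iota 0 N)) ltn) (iota_ltn_sorted 0 N).
    move=> i j _; rewrite mem_iota => /= lt_j lt_ij; exact: staircase_decr.
  exact/allP.
have gtn_trans : transitive gtn by move=> b a c /= ab bc; apply: ltn_trans bc ab.
have sub k k' (s' t' : 'S_N) : (forall i, staircase N k (s' i) = staircase N k' (t' i)) ->
    {subset [seq staircase N k l | l <- iota 0 N] <=
            [seq staircase N k' l | l <- iota 0 N]}.
  move=> E y /mapP[l]; rewrite mem_iota => /= lt_l ->.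
  have := E (s'^-1 (Ordinal lt_l))%g; rewrite permKV /= => ->.
  by apply: map_f; rewrite mem_iota /=.
have E := irr_sorted_eq gtn_trans ltnn (sorted_sc _ kapP) (sorted_sc _ kapP') _.
move=> j lt_j; have := congr1 (nth 0%N ^~ j) (E _).
rewrite !(nth_map 0%N) ?size_iota // nth_iota // add0n => H.
apply/eqP; rewrite -(eqn_add2r (N.-1 - j)); apply/eqP; apply: H => y.
by apply/idP/idP; [apply: sub Est _ | apply: (sub _ _ t s) => i].
Qed.

(** The order is reversed so that the first variables carry the smallest exponents. *)
Definition rev_mon N (g : 'I_N -> 'I_K) kap :=
  mon g (fun i => staircase N kap (rev_ord i)).

Lemma deg_le_alternant N (v : nat -> {mpoly rat[K]}) (g : 'I_N -> 'I_K) kap q :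
  (forall i : 'I_N, v i = 'X_(g i)) -> (forall i, g i != q) ->
  deg_le q 0 (alternant v N kap).
Proof.
move=> vE gq m m_gt0; rewrite (alternantE _ vE) raddf_sum /= big1 // => s _.
rewrite mulr_sign -scaler_sign mcoeffZ mcoeffX; case: eqP => [Em|]; last by rewrite mulr0.
by move: m_gt0; rewrite -Em mon_out.
Qed.

(** If the monomial occurred, the two staircases would be rearrangements of each other. *)
Lemma mcoeff_alternant_neq N (v : nat -> {mpoly rat[K]}) (g : 'I_N -> 'I_K) kap kap' :
  injective g ->
  (forall i : 'I_N, v i = 'X_(g i)) -> noninc kap -> noninc kap' ->
  ~ (forall j, (j < N)%N -> kap j = kap' j) ->
  (alternant v N kap)@_(rev_mon g kap') = 0.
Proof.
move=> g_inj vE kapP kapP' ne; rewrite (alternantE _ vE) raddf_sum /=.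
apply: big1 => s _; rewrite mulr_sign -scaler_sign mcoeffZ mcoeffX.
case: eqP => [E|]; last by rewrite mulr0.
case: ne; pose t := perm (@rev_ord_inj N).
apply: (@staircase_perm_eq _ _ _ s t) => // i; rewrite permE.
by rewrite -(monE (fun i => staircase N kap (s i)) i g_inj) E monE.
Qed.

Lemma mcoeff_alternant_eq N (v : nat -> {mpoly rat[K]}) (g : 'I_N -> 'I_K) kap : injective g ->
  (forall i : 'I_N, v i = 'X_(g i)) -> noninc kap ->
  (alternant v N kap)@_(rev_mon g kap) != 0.
Proof.
move=> g_inj vE kapP; rewrite (alternantE _ vE) raddf_sum /=.
pose t := perm (@rev_ord_inj N).
rewrite (bigD1 t) //= big1 ?addr0 => [|s Hs].
  rewrite mulr_sign -scaler_sign mcoeffZ mcoeffX.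
  rewrite mulf_neq0 ?signr_eq0 //.
  have -> : rev_mon g kap = mon g (fun i => staircase N kap (t i)).
    by apply: eq_bigr => i _; rewrite permE.
  by rewrite eqxx oner_neq0.
rewrite mulr_sign -scaler_sign mcoeffZ mcoeffX; case: eqP => [E|]; last by rewrite mulr0.
case/eqP: Hs; apply/permP => i; apply: (staircase_inj kapP).
by rewrite -(monE (fun i => staircase N kap (s i)) i g_inj) E monE // permE.
Qed.

End Coefficients.

(** * Partitions, plethysm and the final coefficient comparison *)

Lemma part_nth_inj (nu mu : seq nat) : is_part nu -> is_part mu ->
  (forall j, nth 0%N nu j = nth 0%N mu j) -> nu = mu.
Proof.
move=> /andP[_ nu0] /andP[_ mu0] E.
have le_size s t : 0%N \notin s -> (forall j, nth 0%N s j = nth 0%N t j) ->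
    (size s <= size t)%N.
  move=> s0 Est; rewrite leqNgt; apply: contra s0 => lt_ts.
  by rewrite -(nth_default 0%N (leqnn (size t))) -Est mem_nth.
by apply: (@eq_from_nth _ 0%N) => // ; apply/eqP; rewrite eqn_leq !le_size.
Qed.

Lemma size_part_le (nu : seq nat) : is_part nu -> (size nu <= sumn nu)%N.
Proof.
case/andP=> _; elim: nu => //= k nu IH; rewrite inE negb_or eq_sym -lt0n.
by case/andP=> k_gt0 /IH; lia.
Qed.

Lemma pleth_schur_eval (R : comNzRingType) (N C n : nat) (la : seq nat)
    (x : nat -> R) (phi : {rmorphism {mpoly rat[N.+1]} -> R}) :
  is_part la -> (size la <= N.+1)%N -> (nth 0%N la 0 <= C)%N ->
  (forall i : 'I_N.+1, phi 'X_i = x i) ->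
  phi (pleth_p N.+1 n (schur N.+1 la)) =
  gtsum C (fun i => x i ^+ n) N.+1 (nth 0%N la).
Proof.
move=> laP size_la laC phiX.
pose psi : {rmorphism {mpoly rat[N.+1]} -> {mpoly rat[N.+1]}} :=
  comp_mpoly [tuple 'X_l ^+ n | l < N.+1].
apply: (@schur_eval _ N C la (fun i => x i ^+ n) (phi \o psi)) => // i.
by rewrite /= /psi /= comp_mpolyXU -tnth_nth tnth_mktuple rmorphXn phiX.
Qed.

(* <s_mu, p_n o s_la> is the coefficient of s_mu in the Schur expansion of
   p_n o s_la, computed in N >= n|la| variables (where the Schur polynomials
   of partitions with at most N parts are linearly independent and the
   restriction Lambda^d -> Lambda_N^d is an isomorphism). *)
Theorem mainTheorem3 (n : nat) (la mu : seq nat) :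
  (0 < n)%N -> is_part la -> is_part mu ->
  forall (N : nat), (n * sumn la <= N)%N ->
  forall (s : seq (seq nat)) (c : seq nat -> rat),
    uniq s -> all (fun nu => is_part nu && (size nu <= N)%N) s ->
    pleth_p N n (schur N la) = \sum_(nu <- s) c nu *: schur N nu ->
    mu \in s -> c mu != 0 ->
    forall i : nat, (nth 0 la i <= nth 0 mu i)%N.
Proof.
move=> n_gt0 laP muP N le_N s c s_uniq sP E mu_s c_mu i.
rewrite leqNgt; apply/negP => lt_i.
have lt_i_size : (i < size la)%N.
  by rewrite ltnNge; apply: contraTN lt_i => le; rewrite (nth_default _ le).
have size_la : (size la <= N)%N.
  apply: leq_trans (size_part_le laP) (leq_trans _ le_N).
  by rewrite -{1}[sumn la]mul1n leq_mul2r n_gt0 orbT.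
have lt_iN := leq_trans lt_i_size size_la.
case: N => [//|N'] in le_N sP E size_la lt_iN *; set N := N'.+1 in le_N sP E size_la lt_iN *.
(* Indices below [M] are the variables z, those from [M] to [p - 1] the auxiliary y, and those from
   [p] to [K - 1] the [i] variables x, as [K = N + b = p + i]. *)
pose b := (nth 0%N la i).-1; pose M := (N - i)%N; pose p := (M + b)%N.
pose K := (N' + b).+1.
have le_mu : (nth 0%N mu i <= b)%N by rewrite /b; lia.
have lt_b : (b < nth 0%N la i)%N by rewrite /b; lia.
have M_gt0 : (0 < M)%N by rewrite /M; lia.
have MN : (M + i = N)%N by rewrite /M; lia.
have le_pK : (p <= K)%N by rewrite /p /K /M /N; lia.
pose h (j : nat) : 'I_K := inord j.
have hK j : (j < K)%N -> h j = j :> nat by move=> lt_j; rewrite /h inordK.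
pose w (j : nat) : {mpoly rat[K]} := 'X_(h j).
(* The position of the [l]-th original variable, skipping the block of y. *)
pose iv (l : nat) := (if l < M then l else l + b)%N.
have iv_lt l : (l < N)%N -> (iv l < K)%N.
  by rewrite /iv /K /N; case: (ltnP l M) => ? ?; lia.
have iv_inj l l' : iv l = iv l' -> l = l'.
  by rewrite /iv; case: (ltnP l M) => ?; case: (ltnP l' M) => ? ?; lia.
pose v l := w (iv l).
pose g (l : 'I_N) := h (iv l).
have g_inj : injective g.
  move=> l l' /(congr1 (@nat_of_ord _)); rewrite /g !hK ?iv_lt // => El.
  by apply: val_inj; apply: iv_inj.
have vE (l : 'I_N) : v l = 'X_(g l) by [].
have g_out q : (M <= q < p)%N -> forall l, g l != h q.
  move=> /andP[le_q lt_q] l; rewrite -val_eqE /= /g !hK ?iv_lt //; last by lia.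
  by rewrite /iv; case: ltnP => ?; apply/eqP; rewrite /p in lt_q; lia.
pose phi : {rmorphism {mpoly rat[N]} -> {mpoly rat[K]}} :=
  comp_mpoly [tuple v l | l < N].
have phiX (l : 'I_N) : phi 'X_l = v l.
  by rewrite /phi /= comp_mpolyXU -tnth_nth tnth_mktuple.
have part_s nu : nu \in s -> is_part nu /\ (size nu <= N)%N.
  by move/(allP sP)/andP.
pose G := gtsum (nth 0%N la 0) (fun l => v l ^+ n) N (nth 0%N la).
have GE : phi (pleth_p N n (schur N la)) = G by exact: pleth_schur_eval.
have TG : truncated p (G * vdm w 0 p).
  rewrite /G -[X in gtsum _ _ X]MN.
  apply: (@ideal_gtsum _ (truncated p) w (fun l => v l ^+ n) M b n) => //.
  - exact: truncated_ideal.
  - by move=> j e lt_j le_e; apply: truncated_Xn; rewrite // hK // (leq_trans lt_j).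
  - by move=> j lt_j; rewrite /v /iv lt_j.
  - move=> j l lt_l lt_j; apply/eqP => /(congr1 (mcoeff (U_(h j) *+ n))).
    have lt_jK : (j < K)%N by rewrite /K /M /N in lt_j *; lia.
    rewrite /v /iv lt_j (ltn_trans lt_l lt_j) !mcoeffXn eqxx.
    case: eqP => [/mnmP/(_ (h j))|_ /eqP]; last by rewrite oner_eq0.
    rewrite !mulmnE !mnm1E eqxx -val_eqE /= !hK ?(ltn_trans lt_l) //.
    by rewrite ltn_eqF // mul0n mul1n => n0; rewrite -n0 in n_gt0.
  - exact: part_noninc.
clearbody G.
pose F := \sum_(nu <- s) c nu *: alternant v N (nth 0%N nu).
have FE : F = vdm v 0 N * G.
  rewrite -GE E rmorph_sum mulr_sumr; apply: eq_big_seq => nu /part_s[nuP le_nu].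
  rewrite /phi /= comp_mpolyZ -scalerAr; congr (_ *: _).
  rewrite (@alternant_gtsum _ (nth 0%N nu 0)) //; last exact: part_noninc.
  congr (_ * _); apply/esym.
  exact: (@schur_eval _ N' (nth 0%N nu 0) nu v phi).
(* The families [v] and [w] share their first [M] variables, so the Vandermonde factors regroup into
   a multiple of [vdm w 0 p]. *)
have FT : truncated p (F * vdm w M p).
  have -> : F * vdm w M p = vdm v M N * (G * vdm w 0 p).
    rewrite FE.
    have -> : vdm w 0 p = vdm w 0 M * vdm w M p.
      by rewrite /vdm (big_cat_nat _ (n := M)) // leq_addr.
    have -> : vdm v 0 N = vdm w 0 M * vdm v M N.
      rewrite {1}/vdm (big_cat_nat _ (n := M)) //=; last by rewrite -MN leq_addr.
      congr (_ * _); apply: eq_big_nat => j /andP[_ lt_j].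
      apply: eq_bigr => l _; rewrite /v /iv lt_j.
      by rewrite (ltn_trans (ltn_ord l) lt_j).
    ring.
  apply: (idealMl (truncated_ideal K p)); exact: TG.
(* The chosen monomial takes the reversed staircase of [mu] in z and x, and the exponent [q] in each
   auxiliary variable [h q]. *)
have [||q Hq|eps eps0] := @mcoeff_vdm K w h M p F (rev_mon g (nth 0%N mu)) (leq_addr _ _).
- by [].
- move=> j l lt_l lt_j; rewrite -val_eqE /= !hK; first by rewrite ltn_eqF.
    exact: leq_trans le_pK.
  by apply: leq_trans le_pK; apply: ltn_trans lt_j.
- split; last by apply: mon_out; apply: g_out.
  move=> m Hm; rewrite /F raddf_sum big1 // => nu _ /=.
  by rewrite mcoeffZ (deg_le_alternant _ vE (g_out _ Hq)) ?mulr0.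
(* The coefficient vanishes by [FT], although only the alternant of [mu] contributes to it. It
   remains to bound the exponents of the monomial. *)
rewrite FT => [/esym/eqP|o lt_o].
  rewrite mulf_eq0 (negPf eps0) /= /F raddf_sum /= (bigD1_seq mu) //=.
  rewrite [X in _ + X]big1_seq => [|nu /andP[ne_nu nu_s]].
    rewrite addr0 mcoeffZ mulf_eq0 (negPf c_mu).
    by apply/negP; apply: mcoeff_alternant_eq => //; exact: part_noninc.
  have [nuP le_nu] := part_s _ nu_s; have [_ le_muN] := part_s _ mu_s.
  rewrite mcoeffZ (mcoeff_alternant_neq g_inj vE) ?mulr0 //; try exact: part_noninc.
  move=> Enu; case/eqP: ne_nu; apply: part_nth_inj => // j.
  have [/Enu //|le_j] := ltnP j N.
  by rewrite !nth_default // (leq_trans _ le_j).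
rewrite mnmDE.
have sumE : ((\sum_(M <= q < p) U_(h q) *+ q)%MM o = if M <= o then o : nat else 0)%N.
  rewrite mnm_sumE; case: leqP => le_o.
    rewrite (bigD1_seq (o : nat)) ?iota_uniq ?mem_index_iota ?le_o //=.
    have -> : h o = o by apply: val_inj; rewrite /= hK.
    rewrite mulmnE mnm1E eqxx mul1n big1_seq ?addn0 // => q /andP[ne_q].
    rewrite mem_index_iota => /andP[_ lt_q]; rewrite mulmnE mnm1E -val_eqE /= hK.
      by rewrite (negPf ne_q).
    exact: leq_trans le_pK.
  rewrite big_nat_cond big1 // => q; rewrite andbT => /andP[le_q lt_q].
  rewrite mulmnE mnm1E -val_eqE /= hK ?(leq_trans lt_q) //.
  by rewrite gtn_eqF // (leq_trans le_o).
rewrite sumE; case: (leqP M o) => le_o.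
  rewrite /rev_mon mon_out ?addn0 //= => l.
  have <- : h o = o by apply: val_inj; rewrite /= hK.
  by apply: g_out; rewrite le_o.
have lt_oN : (o < N)%N by rewrite -MN (leq_trans le_o) ?leq_addr.
have -> : o = g (Ordinal lt_oN).
  by apply: val_inj; rewrite /g /= hK ?iv_lt // /iv le_o.
rewrite addn0 /rev_mon monE // /staircase /=.
(* For [o < M] the row [N - o.+1] is at least [i], so its part is at most [b] and the exponent at
   most [b + o < p]. *)
have : (nth 0%N mu (N - o.+1) <= nth 0%N mu i)%N.
  apply: noninc_leq; first exact: part_noninc.
  by move: le_o; rewrite /M; lia.
by rewrite /p /M in le_o *; lia.
Qed.
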